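(* Let $A=\mathrm{IDD}(K^1_\infty,1,1)$ be the complex algebra with basis $e_1,e_2,e_3,\ldots$ and bilinear multiplication $e_i\diamond e_j=ij\,e_{i+j-2}$ if $i+j\ge3$, and $e_1\diamond e_1=0$. Then the space of derivations of $A$ is $$\mathfrak{Der}(A)=\langle\varphi,\phi\rangle,\qquad \varphi(e_i)=(i-2)e_i,\quad \phi(e_i)=(1-\delta_{1,i})\,i\,e_{i-1}\quad(i\ge1),$$ where $\delta_{1,i}$ is the Kronecker delta (so $\phi(e_1)=0$).
   Context: A derivation of an algebra $(A,\diamond)$ is a linear map $D:A\to A$ with $D(a\diamond b)=D(a)\diamond b+a\diamond D(b)$ for all $a,b\in A$. $\langle S\rangle$ denotes the linear span of $S$ over $\mathbb C$. *)

(* Defs.v *)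
From HB Require Import structures.
From mathcomp Require Import all_boot all_order all_algebra.
From mathcomp Require Import boolp classical_sets functions reals.
From mathcomp Require Import complex.

Set Implicit Arguments.
Unset Strict Implicit.
Unset Printing Implicit Defensive.

Import Order.TTheory GRing.Theory Num.Theory.
Local Open Scope classical_set_scope.
Local Open Scope complex_scope.
Local Open Scope ring_scope.

Definition is_derivation (F : fieldType) (A : lmodType F) (op : A -> A -> A)
    (D : A -> A) : Prop :=
  linear D /\ forall a b : A, D (op a b) = op (D a) b + op a (D b).

Definition Der (F : fieldType) (A : lmodType F) (op : A -> A -> A) :
    set (A -> A) :=
  [set D | is_derivation op D].

Definition linear_span (F : fieldType) (V : lmodType F) (S : set V) : set V :=
  [set v | exists2 s : seq (F * V), (forall x, x \in s -> S x.2) &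
                                    v = \sum_(x <- s) x.1 *: x.2].

(* Polynomials are used only as the vector space of finitely supported
   sequences of complex numbers: e_i is the monomial 'X^(i - 1) for i >= 1,
   the polynomial product plays no role, and the value at i = 0 is junk. *)
Definition IDD (R : realType) : lmodType R[i] := {poly R[i]}.

Definition IDD_e (R : realType) (i : nat) : IDD R := 'X^(i.-1).

Definition IDD_coord (R : realType) (i : nat) (a : IDD R) : R[i] :=
  (a : {poly R[i]})`_(i.-1).

(* The linear map sending e_i to f i for every i >= 1; the coordinates of a of
   index larger than its size vanish. *)
Definition linext (R : realType) (V : lmodType R[i]) (f : nat -> V)
    (a : IDD R) : V :=
  \sum_(1 <= i < (size (a : {poly R[i]})).+1) IDD_coord i a *: f i.

Definition IDD_table (R : realType) (i j : nat) : IDD R :=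
  if (3 <= i + j)%N then (i * j)%:R *: IDD_e R (i + j - 2) else 0.

Definition IDD_mul (R : realType) (a b : IDD R) : IDD R :=
  linext (fun i => linext (fun j => IDD_table R i j) b) a.

Definition varphi (R : realType) : IDD R -> IDD R :=
  linext (fun i => (i%:R - 2) *: IDD_e R i).

(* For i = 1 the junk vector IDD_e R 0 is multiplied by 0. *)
Definition phi (R : realType) : IDD R -> IDD R :=
  linext (fun i => ((1 - (i == 1%N)%:R) * i%:R) *: IDD_e R (i - 1)).

Lemma linextE (R : realType) (V : lmodType R[i]) (f : nat -> V) (n : nat)
    (a : IDD R) : (size (a : {poly R[i]}) <= n)%N ->
  linext f a = \sum_(1 <= i < n.+1) IDD_coord i a *: f i.
Proof.
move=> le_an; rewrite /linext.
rewrite [RHS](@big_cat_nat _ _ _ (size (a : {poly R[i]})).+1) //=.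
rewrite [X in _ = _ + X]big_nat_cond [X in _ = _ + X]big1 ?addr0 //.
move=> [|i] /andP[/andP[lt_ai _] _] //.
by rewrite /IDD_coord /= nth_default ?scale0r.
Qed.

Lemma linext_linear (R : realType) (V : lmodType R[i]) (f : nat -> V) :
  linear (linext f).
Proof.
move=> k a b.
pose n := maxn (size (a : {poly R[i]})) (size (b : {poly R[i]})).
rewrite (@linextE _ _ f n (k *: a + b)) ?(@linextE _ _ f n a)
  ?(@linextE _ _ f n b) ?leq_maxl ?leq_maxr //; last first.
  apply: leq_trans (size_polyD _ _) _.
  by rewrite geq_max leq_maxr (leq_trans (size_scale_leq _ _)) ?leq_maxl.
rewrite scaler_sumr -big_split /=; apply: eq_bigr => i _.
by rewrite /IDD_coord coefD coefZ scalerDl scalerA.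
Qed.

Lemma linext_e (R : realType) (V : lmodType R[i]) (f : nat -> V) (i : nat) :
  (1 <= i)%N -> linext f (IDD_e R i) = f i.
Proof.
case: i => // i _; rewrite (@linextE _ _ f i.+1) ?size_polyXn //.
rewrite big_nat_recr //= big_nat_cond big1 ?add0r.
  by rewrite /IDD_coord coefXn eqxx scale1r.
move=> [|j] /andP[/andP[_ lt_ji] _] //.
by rewrite /IDD_coord coefXn /= (ltn_eqF (lt_ji : (j < i)%N)) scale0r.
Qed.

Lemma IDD_e_basis (R : realType) (a : IDD R) : a = linext (@IDD_e R) a.
Proof.
rewrite /linext big_add1 /= big_mkord.
rewrite -[LHS](@coefK _ (a : {poly R[i]})) poly_def.
by apply: eq_bigr.
Qed.

Lemma IDD_e_free (R : realType) (n : nat) (c : nat -> R[i]) :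
  \sum_(1 <= i < n.+1) c i *: IDD_e R i = 0 ->
  forall i, (1 <= i <= n)%N -> c i = 0.
Proof.
rewrite big_add1 /= big_mkord => c0 [|i] //= lt_in.
have := congr1 (fun p : {poly R[i]} => p`_i) c0.
rewrite /IDD_e /= -(poly_def n (fun j => c j.+1)).
by rewrite coef_poly coef0 lt_in.
Qed.

Lemma IDD_mul_linearl (R : realType) (b : IDD R) :
  linear (fun a => IDD_mul a b).
Proof. exact: linext_linear. Qed.

Lemma IDD_mul_linearr (R : realType) (a : IDD R) : linear (IDD_mul a).
Proof.
move=> k b c; rewrite /IDD_mul /linext scaler_sumr -big_split /=.
apply: eq_bigr => i _; rewrite -!/(linext _ _) linext_linear scalerDr.
by rewrite !scalerA mulrC.
Qed.

Lemma IDD_mul_e (R : realType) (i j : nat) : (1 <= i)%N -> (1 <= j)%N ->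
  IDD_mul (IDD_e R i) (IDD_e R j) =
  if (3 <= i + j)%N then (i * j)%:R *: IDD_e R (i + j - 2) else 0.
Proof. by move=> i1 j1; rewrite /IDD_mul !linext_e. Qed.

Lemma varphi_e (R : realType) (i : nat) : (1 <= i)%N ->
  varphi (IDD_e R i) = (i%:R - 2) *: IDD_e R i.
Proof. by move=> i1; rewrite /varphi linext_e. Qed.

Lemma phi_e (R : realType) (i : nat) : (1 <= i)%N ->
  phi (IDD_e R i) = ((1 - (i == 1%N)%:R) * i%:R) *: IDD_e R (i - 1).
Proof. by move=> i1; rewrite /phi linext_e. Qed.

(* Main.v *)
Require Import Defs.
From HB Require Import structures.
From mathcomp Require Import all_boot all_order all_algebra.
From mathcomp Require Import boolp classical_sets functions reals.
From mathcomp Require Import complex.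
From mathcomp Require Import ring.

Set Implicit Arguments.
Unset Strict Implicit.
Unset Printing Implicit Defensive.

Import GRing.Theory Num.Theory.
Local Open Scope classical_set_scope.
Local Open Scope ring_scope.

(** The proof exploits the grading of the algebra by the element e_2, since
    e_2 * e_j = 2 j e_j for every j: multiplication by e_2 is twice the Euler
    operator, so its eigenvalues 2 j on the basis are pairwise distinct and an
    eigenvector for 2 k is a multiple of e_k ([IDD_mul_e2_eigen]).

    Let D be a derivation. Applying D to e_2 * e_2 = 4 e_2 gives
    e_2 * D e_2 = 2 D e_2, so D e_2 is a multiple of e_1 = phi e_2 / 2.
    Subtracting a multiple of phi, one may assume D e_2 = 0; then D commutes
    with multiplication by e_2, hence D e_j = d_j e_j for all j
    ([derivation_diag]). The products e_1 * e_3 = 3 e_2 and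
    e_3 * e_j = 3 j e_(j+1) force d_1 = - d_3 and d_(j+1) = d_3 + d_j, whence
    d_j = (j - 2) d_3, that is D = d_3 varphi ([derivation_varphi]).

    Conversely, identifying e_i with x^i, the product is f, g |-> f' g' modulo
    constants, phi is d/dx modulo constants and varphi comes from the grading in
    which e_i has degree i - 2. Both are derivations, which is a computation on
    basis vectors ([is_derivation_basis]); and derivations are stable under
    linear combinations. *)

(** * Linear maps and the basis *)

(* Derivations come as plain functions together with a proof of linearity;
   bundling them gives access to the rewriting rules for linear maps. *)
Section Linear.
Variable F : fieldType.
Variables U V : lmodType F.
Variable f : U -> V.
Hypothesis flin : linear f.

Let fL : {linear U -> V} :=
  HB.pack f (GRing.isLinear.Build F U V *:%R f flin).

Lemma linear_fun0 : f 0 = 0. Proof. exact: (raddf0 fL). Qed.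

Lemma linear_funZ k u : f (k *: u) = k *: f u.
Proof. exact: (linearZ_LR fL). Qed.

Lemma linear_funD u v : f (u + v) = f u + f v.
Proof. exact: (raddfD fL). Qed.

Lemma linear_fun_sum I (r : seq I) (P : pred I) (E : I -> U) :
  f (\sum_(i <- r | P i) E i) = \sum_(i <- r | P i) f (E i).
Proof. exact: (raddf_sum fL). Qed.

End Linear.

Lemma linear_funP (F : fieldType) (U V : lmodType F) (f g : U -> V) k :
  linear f -> linear g -> linear (k *: f + g).
Proof.
move=> flin glin c u v.
have E w : (k *: f + g) w = k *: f w + g w by [].
rewrite !E flin glin !scalerDr !scalerA addrACA.
by rewrite (mulrC k c).
Qed.

Lemma derivationP (F : fieldType) (A : lmodType F) (op : A -> A -> A) k
    (D D' : A -> A) :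
  (forall b, linear (op^~ b)) -> (forall a, linear (op a)) ->
  is_derivation op D -> is_derivation op D' -> is_derivation op (k *: D + D').
Proof.
move=> opl opr [Dlin DM] [D'lin D'M]; split; first exact: linear_funP.
move=> a b.
have E w : (k *: D + D') w = k *: D w + D' w by [].
by rewrite !E DM D'M opr (opl b k) scalerDr addrACA.
Qed.

Section IDD.
Variable R : realType.
Notation e := (IDD_e R).
Notation "a ** b" := (@IDD_mul R a b) (at level 40).

Lemma linear_fun_ext (V : lmodType R[i]) (f g : IDD R -> V) :
  linear f -> linear g ->
  (forall i, (1 <= i)%N -> f (e i) = g (e i)) -> forall a, f a = g a.
Proof.
move=> flin glin fg a.
rewrite [a]IDD_e_basis /linext (linear_fun_sum flin) (linear_fun_sum glin).
rewrite !big_add1; apply: eq_bigr => i _.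
by rewrite (linear_funZ flin) (linear_funZ glin) fg.
Qed.

(** The Leibniz rule is an equality between two maps that are linear in each
    argument, so it need only be tested on basis vectors. *)
Lemma is_derivation_basis (D : IDD R -> IDD R) :
  linear D ->
  (forall i j, (1 <= i)%N -> (1 <= j)%N ->
     D (e i ** e j) = D (e i) ** e j + e i ** D (e j)) ->
  is_derivation (@IDD_mul R) D.
Proof.
move=> Dlin De; split=> // a b.
apply: (@linear_fun_ext _ (fun a => D (a ** b))
  (fun a => D a ** b + a ** D b)) => [k u v|k u v|i i1].
- by rewrite IDD_mul_linearl Dlin.
- by rewrite Dlin !IDD_mul_linearl scalerDr addrACA.
apply: (@linear_fun_ext _ (fun b => D (e i ** b))
  (fun b => D (e i) ** b + e i ** D b)) => [k u v|k u v|j j1].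
- by rewrite IDD_mul_linearr Dlin.
- by rewrite Dlin !IDD_mul_linearr scalerDr addrACA.
- exact: De.
Qed.

Lemma IDD_mulZl k a b : (k *: a) ** b = k *: (a ** b).
Proof. exact: (linear_funZ (@IDD_mul_linearl R b)). Qed.

Lemma IDD_mulZr k a b : a ** (k *: b) = k *: (a ** b).
Proof. exact: (linear_funZ (@IDD_mul_linearr R a)). Qed.

Lemma IDD_eZ_inj k (c d : R[i]) : c *: e k = d *: e k -> c = d.
Proof.
move=> /(congr1 (fun p : {poly R[i]} => p`_k.-1)).
by rewrite /IDD_e !coefZ coefXn eqxx !mulr1.
Qed.

(** * varphi and phi are derivations *)

Lemma varphi_derivation : is_derivation (@IDD_mul R) (@varphi R).
Proof.
have vlin : linear (@varphi R) by exact: linext_linear.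
apply: is_derivation_basis => // i j i1 j1.
rewrite !varphi_e // IDD_mulZl IDD_mulZr IDD_mul_e //.
case: ifP => [ij3|_]; last by rewrite (linear_fun0 vlin) !scaler0 addr0.
have ij2 : (2 <= i + j)%N by exact: ltnW.
rewrite (linear_funZ vlin) varphi_e ?subn_gt0 // !scalerA -scalerDl.
by congr (_ *: _); rewrite natrB // natrD natrM; ring.
Qed.

Lemma phi_eSS i : @phi R (e i.+2) = i.+2%:R *: e i.+1.
Proof. by rewrite phi_e // subr0 mul1r subn1. Qed.

Lemma phi_e1 : @phi R (e 1) = 0.
Proof. by rewrite phi_e // subrr mul0r scale0r. Qed.

Lemma phi_derivation : is_derivation (@IDD_mul R) (@phi R).
Proof.
have plin : linear (@phi R) by exact: linext_linear.
have mul0l b : 0 ** b = 0 by exact: (linear_fun0 (@IDD_mul_linearl R b)).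
have mul0r a : a ** 0 = 0 by exact: (linear_fun0 (@IDD_mul_linearr R a)).
apply: is_derivation_basis => // -[//|[|i]] [//|[|j]] _ _;
  rewrite ?phi_e1 ?phi_eSS ?mul0l ?mul0r ?add0r ?addr0.
- by rewrite IDD_mul_e //= (linear_fun0 plin).
- rewrite IDD_mul_e // IDD_mulZr IDD_mul_e // (linear_funZ plin) /=.
  (* e_1 * e_2 = 2 e_1 is killed by phi, and so is e_1 * e_1 by the product. *)
  case: j => [|j]; first by rewrite phi_e1 !scaler0.
  have -> : (1 + j.+3 - 2 = j.+2)%N by rewrite !addnS add1n subn2.
  have -> : (1 + j.+2 - 2 = j.+1)%N by rewrite !addnS add1n subn2.
  by rewrite phi_eSS !mul1n.
- rewrite IDD_mul_e ?addn1 // IDD_mulZl IDD_mul_e // (linear_funZ plin) /=.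
  case: i => [|i]; first by rewrite phi_e1 !scaler0.
  have -> : (i.+4 - 2 = i.+2)%N by rewrite subn2.
  have -> : (i.+2 + 1 - 2 = i.+1)%N by rewrite addn1 subn2.
  by rewrite phi_eSS !muln1 addn1.
rewrite IDD_mulZl IDD_mulZr !IDD_mul_e // !addSn !addnS !subn2 /=.
rewrite (linear_funZ plin) phi_eSS !scalerA -scalerDl.
congr (_ *: _); rewrite !natrM -!natr1 natrD; ring.
Qed.

(** * Every derivation is a combination of varphi and phi *)

Lemma IDD_mulC (a b : IDD R) : a ** b = b ** a.
Proof.
apply: (@linear_fun_ext _ (fun a => a ** b) (fun a => b ** a)) => [||i i1].
- exact: IDD_mul_linearl.
- exact: IDD_mul_linearr.
apply: (@linear_fun_ext _ (fun b => e i ** b) (fun b => b ** e i)) => [||j j1].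
- exact: IDD_mul_linearr.
- exact: IDD_mul_linearl.
by rewrite !IDD_mul_e // addnC mulnC.
Qed.

Lemma IDD_mul_e2 j : (1 <= j)%N -> e 2 ** e j = (2 * j)%:R *: e j.
Proof. by move=> j1; rewrite IDD_mul_e // ltnS ltnS j1 addKn. Qed.

Lemma coef_IDD_mul_e2 (a : IDD R) k :
  (e 2 ** a : {poly R[i]})`_k = (2 * k.+1)%:R * (a : {poly R[i]})`_k.
Proof.
have coeflin : linear ((fun p : {poly R[i]} => p`_k) : IDD R -> R[i]^o).
  by move=> c u v; rewrite coefD coefZ.
apply: (@linear_fun_ext R[i]^o (fun a => (e 2 ** a : {poly R[i]})`_k)
  (fun a => (2 * k.+1)%:R * (a : {poly R[i]})`_k)) => [c u v|c u v|[//|j] _].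
- by rewrite IDD_mul_linearr coeflin.
- by rewrite coeflin mulrDr; congr (_ + _); exact: mulrCA.
rewrite IDD_mul_e2 // coefZ coefXn /=.
by case: eqP => [->|]; rewrite ?mulr0.
Qed.

(** The coordinate of index j of e_2 * a is 2 j times that of a, so for the
    eigenvalue 2 k every coordinate of index other than k has to vanish. *)
Lemma IDD_mul_e2_eigen (a : IDD R) k : (1 <= k)%N ->
  e 2 ** a = (2 * k)%:R *: a -> exists c, a = c *: e k.
Proof.
case: k => // k _ eig; exists (a : {poly R[i]})`_k.
apply/polyP => j; rewrite coefZ coefXn /=.
case: eqP => [->|/eqP jk]; first by rewrite mulr1.
have := congr1 (fun p : {poly R[i]} => p`_j) eig.
rewrite /= coef_IDD_mul_e2 coefZ => /eqP.
rewrite -subr_eq0 -mulrBl mulf_eq0 subr_eq0 eqr_nat eqn_mul2l /= eqSS.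
by rewrite (negPf jk) /= => /eqP ->; rewrite mulr0.
Qed.

Section Derivation.
Variable D : IDD R -> IDD R.
Hypothesis DD : is_derivation (@IDD_mul R) D.

(** Applying D to e_2 * e_2 = 4 e_2 shows that D e_2 is an eigenvector of
    multiplication by e_2, for the eigenvalue 2 that belongs to e_1. *)
Lemma derivation_e2 : exists c, D (e 2) = c *: e 1.
Proof.
have [Dlin DM] := DD; apply: IDD_mul_e2_eigen => //.
have := DM (e 2) (e 2).
rewrite IDD_mul_e2 // (linear_funZ Dlin) (IDD_mulC (D _)) -mulr2n -[RHS]scaler_nat.
move=> DM2; apply: (@scalerI _ _ 2%:R); first by rewrite pnatr_eq0.
by rewrite -DM2 scalerA -natrM.
Qed.

(** D commutes with multiplication by e_2, hence preserves its eigenlines. *)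
Lemma derivation_diag j : (1 <= j)%N -> D (e 2) = 0 ->
  exists d, D (e j) = d *: e j.
Proof.
move=> j1 De2; have [Dlin DM] := DD; apply: IDD_mul_e2_eigen => //.
have := DM (e 2) (e j).
by rewrite De2 (linear_fun0 (@IDD_mul_linearl R (e j))) add0r IDD_mul_e2 //
  (linear_funZ Dlin).
Qed.

(** The eigenvalue d of D on e_3 determines all others: e_3 * e_j = 3 j e_(j+1)
    climbs from e_2, where the eigenvalue is 0, adding d at each step, and
    e_1 * e_3 = 3 e_2 gives the opposite of d on e_1. *)
Lemma derivation_varphi : D (e 2) = 0 -> exists d, D = d *: @varphi R.
Proof.
move=> De2; have [Dlin DM] := DD.
have [d Dd] := derivation_diag (isT : (1 <= 3)%N) De2; exists d.
have De1 : D (e 1) = (- d) *: e 1.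
  have [d1 Dd1] := derivation_diag (isT : (1 <= 1)%N) De2.
  have := DM (e 1) (e 3).
  rewrite Dd Dd1 IDD_mulZl IDD_mulZr IDD_mul_e // (linear_funZ Dlin) De2.
  rewrite scaler0 -scalerDl scalerA -[0](scale0r (e 2)) => /IDD_eZ_inj /eqP.
  by rewrite eq_sym mulf_eq0 pnatr_eq0 orbF addr_eq0 => /eqP <-.
have DeSS j : D (e j.+2) = (j%:R * d) *: e j.+2.
  elim: j => [|j IH]; first by rewrite De2 mul0r scale0r.
  have := DM (e 3) (e j.+2).
  rewrite Dd IH IDD_mulZl IDD_mulZr IDD_mul_e // (linear_funZ Dlin).
  rewrite -scalerDl => DM3; apply: (@scalerI _ _ (3 * j.+2)%:R).
    by rewrite pnatr_eq0.
  by rewrite DM3 !scalerA -[j.+1%:R]natr1; congr (_ *: _); ring.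
have vlin : linear (d *: @varphi R + 0).
  apply: linear_funP; first exact: linext_linear.
  by move=> k u v; rewrite scaler0 addr0.
rewrite addr0 in vlin.
apply/funext; apply: linear_fun_ext => //.
move=> i i1.
have E w : (d *: @varphi R) w = d *: varphi w by [].
rewrite E varphi_e // scalerA.
case: i i1 => [//|[|j]] _; first by rewrite De1; congr (_ *: _); ring.
by rewrite DeSS; congr (_ *: _); rewrite -addn2 natrD; ring.
Qed.

End Derivation.

(** The multiple of phi to remove from D is read off from phi e_2 = 2 e_1. *)
Lemma derivation_decomp (D : IDD R -> IDD R) :
  is_derivation (@IDD_mul R) D ->
  exists c d, D = c *: @phi R + d *: @varphi R.
Proof.
move=> DD; have [c Dc] := derivation_e2 DD.
have DD' := derivationP (- (c / 2)) (@IDD_mul_linearl R) (@IDD_mul_linearr R)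
  phi_derivation DD.
have [|d Dd] := derivation_varphi DD'.
  have -> : (- (c / 2) *: @phi R + D) (e 2)
    = - (c / 2) *: phi (e 2) + D (e 2) by [].
  rewrite Dc phi_eSS scalerA -scalerDl mulNr divfK ?addNr ?scale0r //.
  by rewrite pnatr_eq0.
by exists (c / 2), d; rewrite -Dd addrA scaleNr subrr add0r.
Qed.

End IDD.

Theorem corollary4p10 (R : realType) :
  Der (@IDD_mul R) = linear_span [set @varphi R; @phi R].
Proof.
apply/seteqP; split=> D.
  move=> /derivation_decomp [c [d ->]].
  exists [:: (c, @phi R); (d, @varphi R)].
    by move=> x; rewrite !inE => /orP[] /eqP -> /=; [right|left].
  by rewrite !big_cons big_nil addr0.
move=> [s sS ->] {D}.
elim: s sS => [|x s IH] sS.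
  rewrite big_nil; split; first by move=> k u v; rewrite scaler0 addr0.
  move=> a b; have E w : (0 : IDD R -> IDD R) w = 0 by [].
  rewrite !E (linear_fun0 (@IDD_mul_linearl R b)).
  by rewrite (linear_fun0 (@IDD_mul_linearr R a)) addr0.
rewrite big_cons; apply: derivationP.
- exact: IDD_mul_linearl.
- exact: IDD_mul_linearr.
- have [->|->] : [set @varphi R; @phi R] x.2 by apply: sS; rewrite mem_head.
    exact: varphi_derivation.
  exact: phi_derivation.
by apply: IH => y ys; apply: sS; rewrite inE ys orbT.
Qed.
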